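(* Let $\mathcal{H}$ be a separable complex Hilbert space, and let $\{f_k\}_{k=1}^{\infty}$ be a Bessel sequence in $\mathcal{H}$ with $f_1\ne 0$, having the form $\{f_k\}_{k=1}^{\infty}=\{T^nf_1\}_{n=0}^{\infty}$ (that is, $f_k=T^{k-1}f_1$ for all $k\ge1$) for some $T\in B(\mathcal{H})$. Then $\{f_k\}_{k=1}^{\infty}$ is a frame for $\mathcal{H}$ if and only if the following two conditions are satisfied: (i) $(T^{*})^n\varphi\to 0$ as $n\to\infty$, for all $\varphi\in\mathcal{H}$; (ii) there exists a boundedly invertible operator $S\in B(\mathcal{H})$ such that $TST^{*}=S-\|f_1\|\Lambda_{f_1}^{e}$, where $e=\frac{f_1}{\|f_1\|}$.
   Context: $B(\mathcal{H})$ denotes the bounded linear operators on $\mathcal{H}$; inner products are linear in the first variable. For a unit vector $e\in\mathcal{H}$ and $g\in\mathcal{H}$, the operator response of $g$ with respect to $e$ is the bounded linear operator $\Lambda_g^e:\mathcal{H}\to\mathcal{H}$, $\Lambda_g^e f=\langle f,g\rangle e$. A sequence $\{f_k\}_{k=1}^\infty$ in $\mathcal{H}$ is a frame for $\mathcal{H}$ if there are constants $A,B>0$ with $A\|f\|^2\le\sum_{k=1}^\infty|\langle f,f_k\rangle|^2\le B\|f\|^2$ for all $f\in\mathcal{H}$; it is a Bessel sequence if the upper inequality holds for some $B>0$ and all $f\in\mathcal{H}$. An operator $S\in B(\mathcal{H})$ is boundedly invertible if it is bijective with bounded inverse. *)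

(* Defs.v *)
From mathcomp Require Export all_boot all_order all_algebra.
From mathcomp Require Export sesquilinear complex.
From mathcomp Require Export all_classical all_reals all_analysis.
Export numFieldNormedType.Exports.

Set Implicit Arguments.
Unset Strict Implicit.
Unset Printing Implicit Defensive.

Import Order.TTheory GRing.Theory Num.Theory.
Local Open Scope classical_set_scope.
Local Open Scope ring_scope.

(* A complex Hilbert space is a [completeNormedModType R[i]] with an inner
   product [dot : {dot H for Num.conj}] such that [`|x| ^+ 2 = dot x x].
   [{dot H for Num.conj}] is linear in its first variable, conjugate-linear in
   its second one, conjugate-symmetric and positive definite. *)

(* Norms over [R[i]] take values in [R[i]] (they are real and nonnegative there);
   this is the same norm as an element of [R]. It applies to vectors and to
   complex numbers alike. *)
Definition rnorm (R : realType) (V : normedZmodType R[i]) (x : V) : R :=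
  complex.Re `|x|.

Definition separable_space (T : topologicalType) : Prop :=
  exists2 D : set T, countable D & dense D.

Section hilbert_operators.
Context {R : realType} {H : completeNormedModType R[i]}.
Variable dot : {dot H for Num.conj}.

Definition bounded_operator (T : H -> H) : Prop :=
  exists M : R, forall x, rnorm (T x) <= M * rnorm x.

Definition boundedly_invertible (S : H -> H) : Prop :=
  exists S' : H -> H, [/\ cancel S S', cancel S' S & bounded_operator S'].

(* [adjoint T g] is the vector [h] such that [dot (T f) g = dot f h] for all [f].
   For bounded linear [T] it exists and is unique by the Riesz representation
   theorem; the default value 0 of [xget] is then never used. *)
Definition adjoint (T : H -> H) (g : H) : H :=
  xget 0 [set h | forall f, dot (T f) g = dot f h].

Definition operator_response (e g : H) : H -> H := fun f => dot f g *: e.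

(* The series has nonnegative terms, so its sum is always defined in [\bar R];
   it is [+oo] when the series diverges. *)
Definition frame_sum (f : nat -> H) (x : H) : \bar R :=
  (\sum_(0 <= k <oo) (rnorm (dot x (f k)) ^+ 2)%:E)%E.

Definition is_bessel (f : nat -> H) : Prop :=
  exists2 B : R, 0 < B &
    forall x, (frame_sum f x <= (B * rnorm x ^+ 2)%:E)%E.

Definition is_frame (f : nat -> H) : Prop :=
  exists A B : R, [/\ 0 < A, 0 < B &
    forall x, ((A * rnorm x ^+ 2)%:E <= frame_sum f x)%E /\
              (frame_sum f x <= (B * rnorm x ^+ 2)%:E)%E].

End hilbert_operators.

(* Main.v *)
From HB Require Import structures.
Require Import Defs.
From mathcomp Require Import ring lra.

Set Implicit Arguments.
Unset Strict Implicit.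
Unset Printing Implicit Defensive.

Import Order.TTheory GRing.Theory Num.Theory.
Local Open Scope classical_set_scope.
Local Open Scope complex_scope.
Local Open Scope ring_scope.

(** Write [f_k = T^k f_0], let [B] be a Bessel bound and let [S_n x] be the
    partial sum [\sum_(k < n) <x, f_k> f_k].  Since [<T^{*n} x, f_k> =
    <x, f_(n + k)>], applying [T^{*n}] shifts the frame coefficients by [n].

    If [f] is a frame with lower bound [A], then [A |T^{*n} x|^2] is at most the
    frame sum of [T^{*n} x], which is the tail from [n] on of the convergent
    frame series of [x]; hence (i).  For (ii) the operator is the frame operator
    [S x = lim S_n x], which exists because the Bessel bound makes [S_n x] a
    Cauchy sequence ([synthesis_bessel]).  The shift turns [T S_n T^*] into
    [S_(n+1)] minus its first term, and the limit is the identity of (ii)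
    ([frame_operator_stein]).  Finally [<S x, x>] is the frame sum of [x], so [S]
    is symmetric, bounded and coercive, and the symmetric Lax-Milgram theorem
    ([lax_milgram]) makes it boundedly invertible.  The same theorem, applied to
    the inner product, is the Riesz theorem that gives [T^*] ([adjointP]).

    Conversely, iterating (ii) gives [S x - S_n x = T^n S T^{*n} x], so that
    [|S x|^2 = <S_n x, S x> + <S T^{*n} x, T^{*n} S x>], where the last term
    vanishes in the limit by (i).  By the Bessel bound [|S_n x|^2] is at most [B]
    times the frame sum of [x]; therefore so is [|S x|^2] ([stein_le]).  Since
    [S] is bounded below, this is a lower frame bound. *)

(** * Real sequences and quadratics *)

Section real_lemmas.
Context {R : realType}.

(** Evaluate the quadratic at its minimiser [t = - b / a]. For [a = 0] it is
    affine, and then bounded below only if [b = 0]. *)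
Lemma discriminant_le (a b c : R) : 0 <= a ->
  (forall t, 0 <= c + 2 * t * b + t ^+ 2 * a) -> b ^+ 2 <= a * c.
Proof.
rewrite le_eqVlt => /predU1P[<- qge0|a0 qge0].
  rewrite mul0r; have [->|b0] := eqVneq b 0; first by rewrite expr0n.
  have := qge0 (- (c + 1) / (2 * b)).
  have -> : c + 2 * (- (c + 1) / (2 * b)) * b + (- (c + 1) / (2 * b)) ^+ 2 * 0 = -1.
    by field.
  by lra.
have := qge0 (- b / a).
have -> : c + 2 * (- b / a) * b + (- b / a) ^+ 2 * a = (a * c - b ^+ 2) / a.
  by field; rewrite gt_eqF.
by rewrite pmulr_lge0 ?invr_gt0// subr_ge0.
Qed.

Lemma cvg_dist_le (u b : nat -> R) (l : R) :
  (forall n, `|u n - l| <= b n) -> b @ \oo --> (0 : R) -> u @ \oo --> l.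
Proof.
move=> ub b0; apply/subr_cvg0/norm_cvg0P.
by apply: (squeeze_cvgr _ (cvg_cst 0) b0); apply: nearW => n; rewrite normr_ge0 ub.
Qed.

End real_lemmas.

(** * The real-valued norm of a complex normed space *)

Section rnorm.
Context {R : realType}.

Lemma ReD (a b : R[i]) : complex.Re (a + b) = complex.Re a + complex.Re b.
Proof. by case: a b => ? ? []. Qed.

Lemma ReZ (a : R) (b : R[i]) : complex.Re (a%:C * b) = a * complex.Re b.
Proof. by case: b => ? ? /=; rewrite mul0r subr0. Qed.

(** A comparison with 0 in [R[i]] forces an element to be real: this is how
    the [R[i]]-valued radii of the topology are turned into real ones. *)
Lemma gt0_complexP (e : R[i]) : 0 < e -> exists2 r : R, 0 < r & e = r%:C.
Proof.
by case: e => r i; rewrite ltcE /= => /andP[/eqP -> r0]; exists r.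
Qed.

Section normed_zmodule.
Context {V : normedZmodType R[i]}.
Implicit Types x y : V.

Lemma norm_rnorm x : `|x| = (rnorm x)%:C.
Proof. by rewrite /rnorm RRe_real// ger0_real. Qed.

Lemma rnorm_ge0 x : 0 <= rnorm x.
Proof. by rewrite -ler0c -norm_rnorm. Qed.

Lemma rnorm0 : rnorm (0 : V) = 0.
Proof. by rewrite /rnorm normr0. Qed.

Lemma rnorm_eq0 x : (rnorm x == 0) = (x == 0).
Proof. by rewrite -[in RHS]normr_eq0 norm_rnorm -(inj_eq (@complexI _)). Qed.

Lemma rnormN x : rnorm (- x) = rnorm x.
Proof. by rewrite /rnorm normrN. Qed.

Lemma rnorm_le_add x y : rnorm (x + y) <= rnorm x + rnorm y.
Proof. by rewrite -lecR rmorphD/= -!norm_rnorm ler_normD. Qed.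

End normed_zmodule.

Lemma Re_mul_le (a b : R[i]) : complex.Re (a * b) <= rnorm a * rnorm b.
Proof.
apply: le_trans (ler_norm _) _.
by rewrite -lecR rmorphM/= -!norm_rnorm -normrM normc_ge_Re.
Qed.

Lemma cvg_rnorm {H : normedModType R[i]} (u : nat -> H) (h : H) :
  u @ \oo --> h <-> (fun n => rnorm (u n - h)) @ \oo --> (0 : R).
Proof.
split=> /cvgrPdist_lt uh; apply/cvgrPdist_lt => e e0.
  have := uh e%:C; rewrite ltcR => /(_ e0); apply: filterS => n.
  by rewrite norm_rnorm ltcR sub0r normrN -rnormN opprB ger0_norm// rnorm_ge0.
have [r r0 ->] := gt0_complexP e0.
have := uh r r0; apply: filterS => n.
by rewrite norm_rnorm ltcR sub0r normrN -rnormN opprB ger0_norm// rnorm_ge0.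
Qed.

Lemma rnorm_cauchy {H : completeNormedModType R[i]} (u : nat -> H) :
  (forall e : R, 0 < e -> exists N, forall m n, (N <= m)%N -> (N <= n)%N ->
     rnorm (u m - u n) < e) -> exists h : H, u @ \oo --> h.
Proof.
move=> uc; suff /cvg_ex[h uh] : cvg (u @ \oo) by exists h.
apply/cauchy_cvgP/cauchy_exP => e e0.
have [r r0 ->] := gt0_complexP e0.
have [N HN] := uc r r0; exists (u N), N => // n /= Nn.
by rewrite -ball_normE /= norm_rnorm ltcR; apply: HN.
Qed.

Lemma cvg_le_rnorm {H : normedModType R[i]} (u : nat -> H) h (c : R) :
  u @ \oo --> h -> (forall n, rnorm (u n) <= c) -> rnorm h <= c.
Proof.
move=> /cvg_rnorm uh uc.
have lim : (fun n => rnorm (u n - h) + c) @ \oo --> 0 + c.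
  by apply: cvgD uh _; exact: cvg_cst.
rewrite -[c]add0r; apply: (cvgr_to_ge lim); apply: nearW => n.
rewrite -{1}(subKr (u n) h); apply: le_trans (rnorm_le_add _ _) _.
by rewrite rnormN addrC lerD2l uc.
Qed.

End rnorm.

Section bounded_operators.
Context {R : realType} {H : completeNormedModType R[i]} (T : {linear H -> H}).
Implicit Types x y : H.

Lemma cvg_bounded (u : nat -> H) h : bounded_operator T ->
  u @ \oo --> h -> (fun n => T (u n)) @ \oo --> T h.
Proof.
move=> [M TM] /cvg_rnorm uh; apply/cvg_rnorm.
apply: (@cvg_dist_le _ _ (fun n => M * rnorm (u n - h))).
  by move=> n; rewrite subr0 ger0_norm ?rnorm_ge0// -linearB TM.
by rewrite -(mulr0 M); apply: cvgMl_tmp.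
Qed.

Lemma iter_linearB n x y : iter n T (x - y) = iter n T x - iter n T y.
Proof. by elim: n => //= n ->; rewrite linearB. Qed.

Lemma iter_linearZ n a x : iter n T (a *: x) = a *: iter n T x.
Proof. by elim: n => //= n ->; rewrite linearZ. Qed.

End bounded_operators.

Section hilbert_space.
Context {R : realType} {H : completeNormedModType R[i]}.
Context (dot : {dot H for Num.conj}).
Context (dot_norm : forall x : H, `|x| ^+ 2 = dot x x).
Implicit Types x y z : H.

(** * The underlying real inner product *)

Definition rdot x y : R := complex.Re (dot x y).

Lemma dotC x y : dot x y = Num.conj (dot y x).
Proof. by rewrite hermC /= expr0 mul1r. Qed.

Lemma rnorm_dotC x y : rnorm (dot x y) = rnorm (dot y x).
Proof. by rewrite dotC /rnorm norm_conjC. Qed.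

Lemma rdotC x y : rdot x y = rdot y x.
Proof. by rewrite /rdot dotC; case: (dot y x). Qed.

Lemma rdotDl x y z : rdot (x + y) z = rdot x z + rdot y z.
Proof. by rewrite /rdot linearDl ReD. Qed.

Lemma rdotDr x y z : rdot x (y + z) = rdot x y + rdot x z.
Proof. by rewrite rdotC rdotDl !(rdotC x). Qed.

Lemma rdotZl (a : R) x y : rdot (a%:C *: x) y = a * rdot x y.
Proof. by rewrite /rdot linearZl_LR/= ReZ. Qed.

Lemma rdotZr (a : R) x y : rdot x (a%:C *: y) = a * rdot x y.
Proof. by rewrite rdotC rdotZl rdotC. Qed.

Lemma rdotBl x y z : rdot (x - y) z = rdot x z - rdot y z.
Proof. by rewrite rdotDl /rdot linearNl raddfN. Qed.

Lemma rdot_norm x : rdot x x = rnorm x ^+ 2.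
Proof. by rewrite /rdot -dot_norm norm_rnorm -rmorphXn. Qed.

(** Cauchy-Schwarz: [|t x + y|^2] is a nonnegative quadratic in [t]. *)
Lemma rdot_le x y : `|rdot x y| <= rnorm x * rnorm y.
Proof.
rewrite -(@ler_pXn2r _ 2) ?nnegrE// ?mulr_ge0 ?rnorm_ge0//.
rewrite real_normK ?num_real// exprMn.
apply: discriminant_le; first exact: sqr_ge0.
move=> t; have := sqr_ge0 (rnorm (t%:C *: x + y)).
rewrite -!rdot_norm !(rdotDl, rdotDr, rdotZl, rdotZr) (rdotC y x).
by move=> h; lra.
Qed.

Lemma cvg_rdot (u : nat -> H) h y :
  u @ \oo --> h -> (fun n => rdot (u n) y) @ \oo --> rdot h y.
Proof.
move=> /cvg_rnorm uh.
apply: (@cvg_dist_le _ _ (fun n => rnorm (u n - h) * rnorm y)).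
  by move=> n; rewrite -rdotBl rdot_le.
by rewrite -(mul0r (rnorm y)); apply: cvgMr_tmp.
Qed.

(** * The symmetric Lax-Milgram theorem and the adjoint *)

(** The direct method: [J x = q x x - 2 l x] is bounded below by coercivity, a
    minimising sequence is Cauchy by the parallelogram identity, and its limit
    [h] satisfies the Euler-Lagrange equation [q h x = l x].  The form [q] and
    the functional [l] are only real-linear, so that the lemma serves both
    [rdot] and the form of a symmetric operator. *)
Lemma lax_milgram (q : H -> H -> R) (l : H -> R) (A C M : R) :
  0 < A ->
  (forall x y, q x y = q y x) ->
  (forall x y z, q (x + y) z = q x z + q y z) ->
  (forall (a : R) x y, q (a%:C *: x) y = a * q x y) ->
  (forall x y, `|q x y| <= C * rnorm x * rnorm y) ->
  (forall x, A * rnorm x ^+ 2 <= q x x) ->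
  (forall x y, l (x + y) = l x + l y) ->
  (forall (a : R) x, l (a%:C *: x) = a * l x) ->
  (forall x, `|l x| <= M * rnorm x) ->
  exists h, forall x, l x = q h x.
Proof.
move=> A0 qC qDl qZl qle qge lD lZ lle.
have qDr x y z : q x (y + z) = q x y + q x z by rewrite qC qDl !(qC x).
have qZr a x y : q x (a%:C *: y) = a * q x y by rewrite qC qZl qC.
have q0 x : 0 <= q x x by apply: le_trans (qge x); rewrite mulr_ge0 ?sqr_ge0 ?ltW.
pose J x := q x x - 2 * l x.
have Jinf : has_inf (range J).
  split; first by exists (J 0), 0.
  (* the minimum of A r^2 - 2 M r over all real r *)
  exists (- (M ^+ 2 / A)) => _ [x _ <-].
  rewrite /J; have := qge x; have := lle x; rewrite ler_norml => /andP[_ lx] qx.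
  have : 0 <= A * (rnorm x - M / A) ^+ 2 by rewrite mulr_ge0 ?sqr_ge0 ?ltW.
  have -> : A * (rnorm x - M / A) ^+ 2 = A * rnorm x ^+ 2 - 2 * (M * rnorm x) + M ^+ 2 / A.
    by field; rewrite gt_eqF.
  by lra.
pose m := inf (range J).
have mJ x : m <= J x by apply: ge_inf; [exact: Jinf.2|exists x].
have /choice[u Ju] (n : nat) : exists x, J x < m + n.+1%:R^-1.
  have [||_ [x _ <-] Jx] := @inf_adherent _ (range J) n.+1%:R^-1 => //.
  by exists x.
(* J at the midpoint of x and y is at least m *)
have Jmid x y : q (x - y) (x - y) <= 2 * (J x - m) + 2 * (J y - m).
  have := mJ (2^-1%:C *: (x + y)); rewrite /J.
  rewrite -[- y]scaleN1r -(rmorphN1 (real_complex R)).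
  rewrite !(qDl, qDr, qZl, qZr, lD, lZ) (qC y x).
  by move=> ?; lra.
have u_cauchy (i j : nat) : A * rnorm (u i - u j) ^+ 2 <= 2 * i.+1%:R^-1 + 2 * j.+1%:R^-1.
  apply: le_trans (qge _) _; apply: le_trans (Jmid _ _) _.
  move: (Ju i) (Ju j); move: i.+1%:R^-1 j.+1%:R^-1 => ei ej.
  by move: (J (u i)) (J (u j)) => Ji Jj; lra.
have [h uh] : exists h : H, u @ \oo --> h.
  apply: rnorm_cauchy => e e0.
  pose d := A * e ^+ 2 / 4.
  have d0 : 0 < d by rewrite !mulr_gt0 ?exprn_gt0 ?invr_gt0.
  have [N _ HN] := near_infty_natSinv_lt (PosNum d0).
  exists N => i j /HN /= id /HN /= jd.
  rewrite -(@ltr_pXn2r _ 2) ?nnegrE ?rnorm_ge0 ?ltW// -(ltr_pM2l A0).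
  apply: le_lt_trans (u_cauchy i j) _; rewrite /d in id jd.
  by move: i.+1%:R^-1 j.+1%:R^-1 id jd => ei ej; lra.
exists h => x.
(* J (u n + t x) >= m for all t: a quadratic in t with constant term J (u n) - m *)
have d_le n : (q (u n) x - l x) ^+ 2 <= q x x * n.+1%:R^-1.
  apply: le_trans (_ : _ <= q x x * (J (u n) - m)) _.
    apply: discriminant_le => // t.
    have := mJ (u n + t%:C *: x); rewrite /J.
    by rewrite !(qDl, qDr, qZl, qZr, lD, lZ) (qC x (u n)) => ?; lra.
  by apply: ler_wpM2l => //; rewrite lerBlDl ltW.
have d_cvg : (fun n => q (u n) x - l x) @ \oo --> q h x - l x.
  apply: (@cvg_dist_le _ _ (fun n => C * rnorm (u n - h) * rnorm x)).
    move=> n; have -> : q (u n) x - l x - (q h x - l x) = q (u n - h) x.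
      by rewrite -[- h]scaleN1r -(rmorphN1 (real_complex R)) qDl qZl; ring.
    exact: qle.
  rewrite -(mul0r (rnorm x)) -(mulr0 C).
  by apply: cvgMr_tmp; apply: cvgMl_tmp; apply/cvg_rnorm.
have d2 : (fun n => (q (u n) x - l x) ^+ 2) @ \oo --> (0 : R).
  apply: (@cvg_dist_le _ _ (fun n => q x x * n.+1%:R^-1)).
    by move=> n; rewrite subr0 ger0_norm ?sqr_ge0.
  rewrite -(mulr0 (q x x)); apply: cvgMl_tmp.
  exact: cvg_harmonic.
have /eqP : (q h x - l x) ^+ 2 = 0.
  by apply: (cvg_unique _ _ d2) => //; rewrite expr2; apply: cvgM.
by rewrite sqrf_eq0 subr_eq0 => /eqP.
Qed.

(** Riesz representation of [x |-> dot (T x) g]. The real form of the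
    Lax-Milgram theorem gives equality of real parts; the imaginary parts agree
    because both sides are complex-linear in [x], so that [x] may be replaced by
    [i x]. *)
Lemma adjointP (T : {linear H -> H}) x g : bounded_operator T ->
  dot (T x) g = dot x (adjoint dot T g).
Proof.
move=> [M TM].
have [h hP] : exists h : H, forall x, rdot (T x) g = rdot h x.
  apply: (@lax_milgram rdot (fun x => rdot (T x) g) 1 1 (M * rnorm g)).
  - by [].
  - exact: rdotC.
  - exact: rdotDl.
  - exact: rdotZl.
  - by move=> y z; rewrite mul1r rdot_le.
  - by move=> y; rewrite mul1r rdot_norm.
  - by move=> y z; rewrite linearD rdotDl.
  - by move=> a y; rewrite linearZ rdotZl.
  - move=> y; apply: le_trans (rdot_le _ _) _.
    by rewrite mulrAC ler_wpM2r ?rnorm_ge0.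
have dotE y : dot (T y) g = dot y h.
  apply/eqP; rewrite eq_complex; apply/andP; split.
    by apply/eqP; have := hP y; rewrite (rdotC h).
  have := hP ('i%C *: y); rewrite (rdotC h) /rdot linearZ/= !linearZl_LR/=.
  by rewrite !(mulrC 'i%C) !ReiNIm => /oppr_inj ->.
by have /(_ x) := xgetPex 0 (ex_intro [set h | forall f, dot (T f) g = dot f h] h dotE).
Qed.

Lemma adjoint_iter (T : {linear H -> H}) n x g : bounded_operator T ->
  dot (iter n T x) g = dot x (iter n (adjoint dot T) g).
Proof.
by move=> Tb; elim: n x g => // n IH x g; rewrite iterS adjointP// IH -iterSr.
Qed.

(** * Bessel sequences and their frame operator *)

Section bessel.
Context (f : nat -> H).

Definition coef_sum x (n : nat) : R := \sum_(0 <= k < n) rnorm (dot x (f k)) ^+ 2.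

Definition synthesis x (n : nat) : H := \sum_(0 <= k < n) dot x (f k) *: f k.

Lemma coef_sum_nondecreasing x : nondecreasing_seq (coef_sum x).
Proof.
apply/nondecreasing_seqP => n.
by rewrite /coef_sum big_nat_recr//= lerDl sqr_ge0.
Qed.

Lemma coef_sum_le_lim x (L : R) n : coef_sum x @ \oo --> L -> coef_sum x n <= L.
Proof.
move=> xL; rewrite -(cvg_lim _ xL)//; apply: nondecreasing_cvgn_le.
  exact: coef_sum_nondecreasing.
by apply/cvg_ex; exists L.
Qed.

Lemma coef_sum_le_frame_sum x n : ((coef_sum x n)%:E <= frame_sum dot f x)%E.
Proof.
rewrite /coef_sum -sumEFin; apply: nneseries_lim_ge => k _ _.
by rewrite lee_fin sqr_ge0.
Qed.

Lemma frame_sum_value_ge0 x (L : R) : frame_sum dot f x = L%:E -> 0 <= L.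
Proof.
move=> xL; rewrite -lee_fin -xL.
by apply: nneseries_ge0 => k _ _; rewrite lee_fin sqr_ge0.
Qed.

Lemma cvg_coef_sum (C : R) x : (frame_sum dot f x <= C%:E)%E ->
  exists2 L : R, frame_sum dot f x = L%:E & coef_sum x @ \oo --> L.
Proof.
move=> xC.
have fin : frame_sum dot f x \is a fin_num.
  rewrite fin_numElt (lt_le_trans _ (coef_sum_le_frame_sum x 0)) ?ltNyr//.
  by rewrite (le_lt_trans xC) ?ltry.
exists (fine (frame_sum dot f x)); first by rewrite fineK.
have : (fun n => (coef_sum x n)%:E) @ \oo --> frame_sum dot f x.
  under eq_fun do rewrite /coef_sum -sumEFin.
  by apply: is_cvg_nneseries => k _ _; rewrite lee_fin sqr_ge0.
by rewrite -{1}(fineK fin) => /fine_cvg.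
Qed.

Lemma synthesis_linear n : linear (synthesis^~ n).
Proof.
move=> a x y; rewrite /synthesis scaler_sumr -big_split/=.
by apply: eq_bigr => k _; rewrite linearDl linearZl_LR/= scalerDl scalerA.
Qed.

Lemma rdot_synthesis x y n :
  rdot (synthesis x n) y = complex.Re (\sum_(0 <= k < n) dot x (f k) * dot (f k) y).
Proof.
rewrite /rdot linear_sumlz; congr (complex.Re _).
by apply: eq_bigr => k _; rewrite linearZl_LR.
Qed.

Lemma rdot_synthesis_sym x y n : rdot (synthesis x n) y = rdot (synthesis y n) x.
Proof.
rewrite !rdot_synthesis !raddf_sum; apply: eq_bigr => k _ /=.
rewrite (dotC y) (dotC _ x).
by case: (dot x (f k)) (dot (f k) y) => a b [c d] /=; ring.
Qed.

Lemma rdot_synthesis_diag x n : rdot (synthesis x n) x = coef_sum x n.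
Proof.
rewrite rdot_synthesis raddf_sum; apply: eq_bigr => k _ /=.
have -> : dot x (f k) * dot (f k) x = `|dot x (f k)| ^+ 2.
  by rewrite (dotC _ x) normCK.
by rewrite norm_rnorm -rmorphXn.
Qed.

Context (B : R) (B0 : 0 < B).
Context (fB : forall x, (frame_sum dot f x <= (B * rnorm x ^+ 2)%:E)%E).

Lemma coef_sum_bessel x n : coef_sum x n <= B * rnorm x ^+ 2.
Proof. by rewrite -lee_fin; apply: le_trans (coef_sum_le_frame_sum x n) (fB x). Qed.

(** The synthesis operator, dual to the analysis operator, has the same bound.
    With [v] the difference and [c_k = <x, f_k>], expand
    [|v|^2 = \sum_k Re (c_k <f_k, v>)] and bound each term by
    [(B |c_k|^2 + B^-1 |<v, f_k>|^2) / 2]: by the Bessel inequality the second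
    parts add up to at most [|v|^2 / 2], which is absorbed on the left. *)
Lemma synthesis_bessel x m n : (m <= n)%N ->
  rnorm (synthesis x n - synthesis x m) ^+ 2 <= B * (coef_sum x n - coef_sum x m).
Proof.
move=> mn.
have tail (V : zmodType) (F : nat -> V) :
    \sum_(0 <= k < n) F k - \sum_(0 <= k < m) F k = \sum_(m <= k < n) F k.
  by rewrite (big_cat_nat _ mn)//= addrAC subrr add0r.
rewrite /synthesis tail; set v := \sum_(m <= k < n) _.
have vB : \sum_(m <= k < n) rnorm (dot v (f k)) ^+ 2 <= B * rnorm v ^+ 2.
  rewrite -tail; apply: le_trans (coef_sum_bessel v n).
  by rewrite lerBlDr lerDl sumr_ge0// => k _; apply: sqr_ge0.
rewrite /coef_sum tail; set c := \sum_(m <= k < n) rnorm (dot x _) ^+ 2.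
suff : rnorm v ^+ 2 <= 2^-1 * (B * c + B^-1 * (B * rnorm v ^+ 2)).
  by rewrite mulKf ?gt_eqF// => ?; lra.
apply: (@le_trans _ _
  (2^-1 * (B * c + B^-1 * \sum_(m <= k < n) rnorm (dot v (f k)) ^+ 2))); last first.
  by rewrite ler_pM2l ?invr_gt0// lerD2l ler_pM2l ?invr_gt0.
rewrite -rdot_norm {1}/v /rdot linear_sumlz raddf_sum/= /c.
rewrite !mulr_sumr -big_split/= mulr_sumr.
apply: ler_sum => k _; rewrite linearZl_LR/=.
apply: le_trans (Re_mul_le _ _) _.
rewrite (rnorm_dotC (f k)); set a := rnorm _; set b := rnorm _.
have : 0 <= B^-1 * (B * a - b) ^+ 2 by rewrite mulr_ge0 ?sqr_ge0 ?invr_ge0 ?ltW.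
have -> : B^-1 * (B * a - b) ^+ 2 = B * a ^+ 2 - 2 * (a * b) + B^-1 * b ^+ 2.
  by field; rewrite gt_eqF.
by lra.
Qed.

Lemma synthesis_le x n : rnorm (synthesis x n) ^+ 2 <= B * coef_sum x n.
Proof.
have := synthesis_bessel x (leq0n n).
by rewrite {2}/synthesis {2}/coef_sum !big_geq// !subr0.
Qed.

Lemma cvg_synthesis x : exists h : H, synthesis x @ \oo --> h.
Proof.
have [L _ xL] := cvg_coef_sum (fB x).
apply: rnorm_cauchy => e e0.
have Le : L - e ^+ 2 / B < L by rewrite ltrBlDr ltrDl divr_gt0 ?exprn_gt0.
have [N _ HN] := cvgr_gt _ xL _ Le.
have close m n : (N <= m)%N -> (m <= n)%N -> rnorm (synthesis x n - synthesis x m) < e.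
  move=> Nm mn; rewrite -(@ltr_pXn2r _ 2) ?nnegrE ?rnorm_ge0 ?ltW//.
  apply: le_lt_trans (synthesis_bessel x mn) _.
  rewrite mulrC -ltr_pdivlMr//.
  by have := HN m Nm; have := coef_sum_le_lim n xL => /= ? ?; lra.
exists N => m n Nm Nn; have [mn|/ltnW nm] := leqP m n; last exact: close.
by rewrite -rnormN opprB; exact: close.
Qed.

Lemma frame_operator_exists : exists S : {linear H -> H},
  forall x, synthesis x @ \oo --> S x.
Proof.
have /choice[S HS] (x : H) : exists h : H, synthesis x @ \oo --> h.
  exact: cvg_synthesis x.
have Slin : linear S.
  move=> a x y; apply: (cvg_unique _ (HS _)) => //.
  have -> : synthesis (a *: x + y) = (fun n => a *: synthesis x n + synthesis y n).
    by apply/funext => n; rewrite synthesis_linear.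
  by apply: cvgD (HS y); apply: cvgZ (HS x); exact: cvg_cst.
pose S' : {linear H -> H} := HB.pack S (GRing.isLinear.Build _ _ _ _ S Slin).
by exists S'.
Qed.

Section frame_operator.
Context (S : {linear H -> H}) (S_cvg : forall x, synthesis x @ \oo --> S x).

Lemma frame_operator_bounded x : rnorm (S x) <= B * rnorm x.
Proof.
apply: (cvg_le_rnorm (@S_cvg x)) => n.
have Bx : 0 <= B * rnorm x by rewrite mulr_ge0 ?rnorm_ge0// ltW.
rewrite -(@ler_pXn2r _ 2) ?nnegrE ?rnorm_ge0//.
apply: le_trans (synthesis_le x n) _.
by rewrite exprMn [in leRHS]expr2 -mulrA ler_pM2l// coef_sum_bessel.
Qed.

Lemma frame_operator_sym x y : rdot (S x) y = rdot (S y) x.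
Proof.
apply: (cvg_unique _ (cvg_rdot (y := y) (@S_cvg x))) => //=.
under eq_fun do rewrite rdot_synthesis_sym.
exact: (cvg_rdot (y := x) (@S_cvg y)).
Qed.

Lemma frame_operator_diag x : frame_sum dot f x = (rdot (S x) x)%:E.
Proof.
have [L -> xL] := cvg_coef_sum (fB x); congr (_%:E).
apply: (cvg_unique _ xL) => //=.
have <- : (fun n => rdot (synthesis x n) x) = coef_sum x.
  by apply/funext => n; exact: rdot_synthesis_diag.
exact: (cvg_rdot (y := x) (@S_cvg x)).
Qed.

(** The lower frame bound says that the form [rdot (S x) y] is coercive, so
    surjectivity of [S] is the Lax-Milgram theorem for the functional
    [rdot ^~ y]; injectivity and the bound on the inverse come from
    [A |x| <= |S x|]. *)
Lemma frame_operator_invertible (A : R) : 0 < A ->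
  (forall x, ((A * rnorm x ^+ 2)%:E <= frame_sum dot f x)%E) ->
  boundedly_invertible S.
Proof.
move=> A0 fA.
have SA x : A * rnorm x ^+ 2 <= rdot (S x) x.
  by rewrite -lee_fin -frame_operator_diag.
have S_below x : rnorm x <= A^-1 * rnorm (S x).
  have [->|x0] := eqVneq x 0; first by rewrite linear0 rnorm0 mulr0.
  have rx : 0 < rnorm x by rewrite lt0r rnorm_eq0 x0 rnorm_ge0.
  rewrite -ler_pdivrMl ?invr_gt0// invrK -(ler_pM2r rx) -mulrA -expr2.
  apply: le_trans (SA x) _; apply: le_trans (ler_norm _) _.
  exact: rdot_le.
have /choice[S' S'P] (y : H) : exists h : H, S h = y.
  have [h hP] : exists h : H, forall x, rdot x y = rdot (S h) x.
    apply: (@lax_milgram (fun x z => rdot (S x) z) (rdot^~ y) A B (rnorm y)) => //.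
    - exact: frame_operator_sym.
    - by move=> a b c; rewrite linearD rdotDl.
    - by move=> a b c; rewrite linearZ rdotZl.
    - move=> a b; apply: le_trans (rdot_le _ _) _.
      by rewrite ler_wpM2r ?rnorm_ge0 ?frame_operator_bounded.
    - by move=> a b; rewrite rdotDl.
    - by move=> a b; rewrite rdotZl.
    - by move=> a; rewrite mulrC rdot_le.
  exists h; apply/eqP; rewrite -subr_eq0 -rnorm_eq0 -sqrf_eq0.
  by rewrite -rdot_norm rdotBl -hP rdotC subrr.
exists S'; split => //.
- move=> x; apply/eqP; rewrite -subr_eq0 -rnorm_eq0 eq_le rnorm_ge0 andbT.
  by apply: le_trans (S_below _) _; rewrite linearB S'P subrr rnorm0 mulr0.
- by exists A^-1 => x; rewrite -{2}(S'P x).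
Qed.

End frame_operator.

(** * Orbits of a bounded operator *)

Section orbit.
Context (T : {linear H -> H}) (T_bounded : bounded_operator T).
Context (f_orbit : forall n : nat, f n = iter n T (f 0%N)).
Local Notation Ts := (adjoint dot T).

Lemma dot_adjoint_orbit x n k : dot (iter n Ts x) (f k) = dot x (f (n + k)%N).
Proof.
rewrite dotC -adjoint_iter// [RHS]dotC.
by rewrite (f_orbit k) (f_orbit (n + k)) iterD.
Qed.

Lemma coef_sum_adjoint x n m :
  coef_sum (iter n Ts x) m = coef_sum x (n + m) - coef_sum x n.
Proof.
rewrite /coef_sum (big_cat_nat _ (leq_addr m n))//= addrAC subrr add0r.
have := @big_addn _ 0 +%R 0 (n + m) n xpredT (fun k => rnorm (dot x (f k)) ^+ 2).
rewrite add0n addKn => ->.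
by apply: eq_bigr => k _; rewrite dot_adjoint_orbit addnC.
Qed.

(** The frame sum of [T^{*n} x] is the tail of the frame series of [x]. *)
Lemma frame_adjoint_cvg0 (A : R) : 0 < A ->
  (forall x, ((A * rnorm x ^+ 2)%:E <= frame_sum dot f x)%E) ->
  forall x, (fun n => iter n Ts x) @ \oo --> (0 : H).
Proof.
move=> A0 fA x; have [L _ xL] := cvg_coef_sum (fB x).
have tail n : A * rnorm (iter n Ts x) ^+ 2 <= L - coef_sum x n.
  rewrite -lee_fin; apply: le_trans (fA _) _.
  have [L' -> cvL'] := cvg_coef_sum (fB (iter n Ts x)); rewrite lee_fin.
  apply: (cvgr_to_le cvL'); apply: nearW => m.
  by rewrite coef_sum_adjoint lerD2r coef_sum_le_lim.
have sq : (fun n => rnorm (iter n Ts x) ^+ 2) @ \oo --> (0 : R).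
  apply: (@cvg_dist_le _ _ (fun n => A^-1 * (L - coef_sum x n))).
    by move=> n; rewrite subr0 ger0_norm ?sqr_ge0// ler_pdivlMl.
  rewrite -(mulr0 A^-1) -(subrr L); apply: cvgMl_tmp.
  by apply: cvgB => //; exact: cvg_cst.
apply/cvg_rnorm; under eq_fun do rewrite subr0.
apply/cvgrPdist_lt => e e0.
move/cvgrPdist_lt : sq => /(_ _ (exprn_gt0 2 e0)); apply: filterS => n.
rewrite !sub0r !normrN !ger0_norm ?sqr_ge0 ?rnorm_ge0//.
by rewrite ltr_pXn2r// nnegrE ?rnorm_ge0 ?ltW.
Qed.

(** [T] moves [<T^* x, f_k> f_k = <x, f_(k+1)> f_k] to the next term of the
    series of [S x], so only the first term of that series is lost. *)
Lemma frame_operator_stein (S : {linear H -> H}) :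
  (forall x, synthesis x @ \oo --> S x) ->
  forall x, T (S (Ts x)) = S x - dot x (f 0%N) *: f 0%N.
Proof.
move=> S_cvg x; apply: (cvg_unique _ (cvg_bounded T_bounded (S_cvg (Ts x)))) => //.
rewrite (_ : (fun n => _) =
  (fun n => synthesis x n.+1 - dot x (f 0%N) *: f 0%N)); last first.
  apply/funext => n; rewrite /synthesis big_nat_recl//= addrAC subrr add0r linear_sum/=.
  apply: eq_bigr => k _; rewrite linearZ/= (dot_adjoint_orbit x 1 k) add1n.
  by rewrite [f k.+1]f_orbit iterS -f_orbit.
apply: cvgB; last exact: cvg_cst.
by rewrite (cvg_shiftS (synthesis x)); exact: S_cvg.
Qed.

Section stein_equation.
Context (S : {linear H -> H}).
Context (S_stein : forall x, T (S (Ts x)) = S x - dot x (f 0%N) *: f 0%N).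

Lemma stein_iter x n : iter n T (S (iter n Ts x)) = S x - synthesis x n.
Proof.
elim: n => [|n IH]; first by rewrite /synthesis big_geq// subr0.
rewrite iterSr [iter n.+1 Ts x]iterS S_stein iter_linearB IH iter_linearZ.
rewrite -f_orbit dot_adjoint_orbit addn0 /synthesis big_nat_recr//= opprD.
by rewrite addrA.
Qed.

(** Pairing [S x = synthesis x n + T^n S T^{*n} x] with [S x] leaves, in the
    limit, only the first summand, whose norm is controlled by
    [synthesis_le]; thus [|S x|^2 <= sqrt (B L) |S x|]. *)
Lemma stein_le : bounded_operator S ->
  (forall x, (fun n => iter n Ts x) @ \oo --> (0 : H)) ->
  forall x (L : R), frame_sum dot f x = L%:E -> rnorm (S x) ^+ 2 <= B * L.
Proof.
move=> [M SM] Ts0 x L xL.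
have L0 : 0 <= B * L.
  by rewrite mulr_ge0 ?(ltW B0)// (frame_sum_value_ge0 xL).
have synthesisB n : rnorm (synthesis x n) <= Num.sqrt (B * L).
  rewrite -(@ler_pXn2r _ 2) ?nnegrE ?rnorm_ge0 ?sqrtr_ge0// sqr_sqrtr//.
  apply: le_trans (synthesis_le x n) _; rewrite ler_pM2l// -lee_fin -xL.
  exact: coef_sum_le_frame_sum.
have norm0 y : (fun n => rnorm (iter n Ts y)) @ \oo --> (0 : R).
  by have /cvg_rnorm := Ts0 y; under eq_fun do rewrite subr0.
have key : rnorm (S x) ^+ 2 <= Num.sqrt (B * L) * rnorm (S x).
  have lim : (fun n => Num.sqrt (B * L) * rnorm (S x) +
      M * (rnorm (iter n Ts x) * rnorm (iter n Ts (S x)))) @ \oo -->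
      Num.sqrt (B * L) * rnorm (S x) + M * (0 * 0).
    apply: cvgD; first exact: cvg_cst.
    by apply: cvgMl_tmp; apply: cvgM.
  rewrite -[leRHS]addr0 -(mulr0 M) -[X in M * X](mulr0 0).
  apply: (cvgr_to_ge lim); apply: nearW => n.
  rewrite -rdot_norm.
  have -> : rdot (S x) (S x) = rdot (synthesis x n) (S x) +
      rdot (S (iter n Ts x)) (iter n Ts (S x)).
    rewrite /rdot -adjoint_iter// stein_iter -ReD -linearDl.
    by rewrite addrC subrK.
  apply: lerD; apply: le_trans (ler_norm _) (le_trans (rdot_le _ _) _).
    by rewrite ler_wpM2r ?rnorm_ge0.
  by rewrite mulrA ler_wpM2r ?rnorm_ge0.
have [->|Sx0] := eqVneq (rnorm (S x)) 0; first by rewrite expr0n.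
rewrite -(sqr_sqrtr L0) ler_pXn2r ?nnegrE ?rnorm_ge0 ?sqrtr_ge0//.
by rewrite -(@ler_pM2r _ (rnorm (S x))) -?expr2// lt0r Sx0 rnorm_ge0.
Qed.

End stein_equation.
End orbit.
End bessel.

Lemma scaled_response (g x : H) : g != 0 ->
  `|g| *: operator_response dot (`|g|^-1 *: g) g x = dot x g *: g.
Proof.
move=> g0; rewrite /operator_response !scalerA mulrAC divff ?mul1r//.
by rewrite normr_eq0.
Qed.

End hilbert_space.

(** * Frames that are orbits *)

(* The sequence is indexed from 0: [f n] is the vector written f_(n+1) with
   indices starting at 1. *)
Theorem proposition2p4 (R : realType) (H : completeNormedModType R[i])
    (dot : {dot H for Num.conj})
    (dot_norm : forall x : H, `|x| ^+ 2 = dot x x)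
    (H_separable : separable_space H)
    (f : nat -> H) (f_bessel : is_bessel dot f) (f0_neq0 : f 0%N != 0)
    (T : {linear H -> H}) (T_bounded : bounded_operator T)
    (f_orbit : forall n : nat, f n = iter n T (f 0%N)) :
  is_frame dot f <->
  (forall phi : H,
      (fun n : nat => iter n (adjoint dot T) phi) @ \oo --> (0 : H)) /\
  (exists S : {linear H -> H},
      [/\ bounded_operator S,
          boundedly_invertible S &
          let e := `|f 0%N|^-1 *: f 0%N in
          forall x : H,
            T (S (adjoint dot T x)) =
            S x - `|f 0%N| *: operator_response dot e (f 0%N) x]).
Proof.
have [B B0 fB] := f_bessel; split.
  move=> [A [B' [A0 _ fAB]]].
  have fA x : ((A * rnorm x ^+ 2)%:E <= frame_sum dot f x)%E by case: (fAB x).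
  split; first exact: (frame_adjoint_cvg0 dot_norm fB T_bounded f_orbit A0 fA).
  have [S S_cvg] := frame_operator_exists dot_norm B0 fB.
  exists S; split.
  - exists B; exact: (frame_operator_bounded dot_norm B0 fB S_cvg).
  - exact: (frame_operator_invertible dot_norm B0 fB S_cvg A0 fA).
  - move=> e x; rewrite scaled_response//.
    exact: (frame_operator_stein dot_norm T_bounded f_orbit S_cvg).
move=> [Ts0 [S [S_bounded [S' [SK _ [M S'M]]] S_stein]]].
have S_stein' x : T (S (adjoint dot T x)) = S x - dot x (f 0%N) *: f 0%N.
  by rewrite -scaled_response.
(* From |x| <= M |S x| and |S x|^2 <= B L, the lower bound is 1 / (M^2 B); the
   added 1 keeps it well defined when M = 0. *)
have MB : 0 < M ^+ 2 * B + 1 by rewrite ltr_wpDl// mulr_ge0 ?sqr_ge0 ?ltW.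
exists (M ^+ 2 * B + 1)^-1, B; split => [||x]; [by rewrite invr_gt0|by []|split => //].
have [L xL _] := cvg_coef_sum (fB x); rewrite xL lee_fin ler_pdivrMl//.
have := stein_le dot_norm B0 fB T_bounded f_orbit S_stein' S_bounded Ts0 xL.
have L0 := frame_sum_value_ge0 xL.
have Mx : rnorm x ^+ 2 <= M ^+ 2 * rnorm (S x) ^+ 2.
  have xMS : rnorm x <= M * rnorm (S x) by rewrite -{1}(SK x).
  rewrite -exprMn ler_pXn2r ?nnegrE ?rnorm_ge0//.
  exact: le_trans (rnorm_ge0 x) xMS.
move=> SxL; apply: le_trans Mx _.
by apply: le_trans (ler_wpM2l (sqr_ge0 M) SxL) _; rewrite mulrDl mulrA mul1r lerDl.
Qed.
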